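(* Let $R$ be a commutative artin ring and $(\mathcal{C},\mathbb{E},\mathfrak{s})$ an $R$-linear Ext-finite extriangulated category with a right ARS duality $(\tau,\eta)$. Let $\iota:\mathbb{F}\hookrightarrow\mathbb{E}$ be a closed subfunctor. Then $(\tau,\eta)$ induces a right ARS duality $(\tau_{\mathbb{F}},\eta^{\mathbb{F}})$ on the relative theory $(\mathcal{C},\mathbb{F},\mathfrak{s}|_{\mathbb{F}})$; here $\tau_{\mathbb{F}}:\mathcal{C}/\mathcal{P}_{\mathbb{F}}\to\mathcal{C}/\mathcal{I}_{\mathbb{F}}$ is an $R$-linear functor and $\eta^{\mathbb{F}}_{A,B}:(\mathcal{C}/\mathcal{P}_{\mathbb{F}})(A,B)\xrightarrow{\sim}\mathbb{D}\mathbb{F}(B,\tau_{\mathbb{F}}A)$ is a binatural isomorphism of $R$-modules. Moreover, with $\pi:\underline{\mathcal{C}}\to\mathcal{C}/\mathcal{P}_{\mathbb{F}}$ and $\pi':\overline{\mathcal{C}}\to\mathcal{C}/\mathcal{I}_{\mathbb{F}}$ the canonical functors, the following commute: $\pi'\circ\tau=\tau_{\mathbb{F}}\circ\pi$ as functors $\underline{\mathcal{C}}\to\mathcal{C}/\mathcal{I}_{\mathbb{F}}$, and for all $A,B\in\mathcal{C}$, $$\mathbb{D}(\iota)\circ\eta_{A,B}=\eta^{\mathbb{F}}_{A,B}\circ\pi:\ \underline{\mathcal{C}}(A,B)\to\mathbb{D}\mathbb{F}(B,\tau_{\mathbb{F}}A),$$ where $\mathbb{D}(\iota):\mathbb{D}\mathbb{E}(B,\tau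 A)\to\mathbb{D}\mathbb{F}(B,\tau_{\mathbb{F}}A)$ is restriction along $\mathbb{F}(B,\tau A)\subseteq\mathbb{E}(B,\tau A)$.
   Context: $J$ is the minimal injective cogenerator of the category $\mathrm{mod}R$ of finitely generated $R$-modules and $\mathbb{D}=\mathrm{Hom}_R(-,J)$. Extriangulated categories (Nakaoka–Palu). An $R$-linear extriangulated category is a triplet $(\mathcal{C},\mathbb{E},\mathfrak{s})$ where $\mathcal{C}$ is an $R$-linear additive category, (ET1) $\mathbb{E}:\mathcal{C}^{\rm op}\times\mathcal{C}\to\mathrm{Mod}R$ is an $R$-bilinear functor, (ET2) $\mathfrak{s}$ is an additive realization of $\mathbb{E}$, and (ET3), (ET4) and their duals hold. For $\delta\in\mathbb{E}(C,A)$, $c:C'\to C$, $a:A\to A'$ write $c^*\delta=\mathbb{E}(c,A)(\delta)$, $a_*\delta=\mathbb{E}(C,a)(\delta)$. A morphism $\delta\to\delta'$ from $\delta\in\mathbb{E}(C,A)$ to $\delta'\in\mathbb{E}(C',A')$ is a pair $(a:A\to A',c:C\to C')$ with $a_*\delta=c^*\delta'$. An additive realization assigns to each $\delta\in\mathbb{E}(C,A)$ an equivalence class $\mathfrak{s}(\delta)=[A\to B\to C]$ (sequences equivalent if there is an isomorphism of middle terms compatible with $\mathrm{id}_A,\mathrm{id}_C$) such that each morphism $(a,c):\delta\to\delta'$ extends to a commutative diagram between realizing sequences, $\mathfrak{s}(0)=[A\to A\oplus C\to C]$, and $\mathfrak{s}(\delta\oplus\delta')=\mathfrak{s}(\delta)\oplus\mathfrak{s}(\delta')$.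 (ET3): if $\mathfrak{s}(\delta)=[A\xrightarrow{x}B\xrightarrow{y}C]$, $\mathfrak{s}(\delta')=[A'\xrightarrow{x'}B'\xrightarrow{y'}C']$ and $bx=x'a$, there is $c$ with $cy=y'b$ and $(a,c):\delta\to\delta'$ a morphism. (ET4): if $\delta\in\mathbb{E}(D,A)$, $\delta'\in\mathbb{E}(F,B)$ are realized by $A\xrightarrow{f}B\xrightarrow{f'}D$, $B\xrightarrow{g}C\xrightarrow{g'}F$, there are $E$, $d:D\to E$, $e:E\to F$, $h'\colon C\to E$ and $\delta''\in\mathbb{E}(E,A)$ realized by $A\xrightarrow{h=gf}C\xrightarrow{h'}E$ with $h'g=df'$, $eh'=g'$, such that $D\xrightarrow{d}E\xrightarrow{e}F$ realizes $f'_*\delta'$, $d^*\delta''=\delta$, $f_*\delta''=e^*\delta'$. If $\mathfrak{s}(\delta)=[A\xrightarrow{a}B\xrightarrow{b}C]$, then $A\xrightarrow{a}B\xrightarrow{b}C\overset{\delta}{\dashrightarrow}$ is an $\mathfrak{s}$-triangle, $a$ an $\mathfrak{s}$-inflation, $b$ an $\mathfrak{s}$-deflation. Ext-finite: every $\mathbb{E}(C,A)$ is a finitely generated $R$-module. Closed subfunctor: an $R$-bilinear subfunctor $\mathbb{F}\subseteq\mathbb{E}$ such that $(\mathcal{C},\mathbb{F},\mathfrak{s}|_{\mathbb{F}})$ (with $\mathfrak{s}|_{\mathbb{F}}$ the restriction of $\mathfrak{s}$) is extriangulated; equivalently $\mathfrak{s}|_{\mathbb{F}}$-inflations (or $\mathfrak{s}|_{\mathbb{F}}$-deflations)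 are closed under composition. Then $(\mathcal{C},\mathbb{F},\mathfrak{s}|_{\mathbb{F}})$ is called a relative theory. Stable categories and ARS duality. For an extriangulated structure $(\mathbb{G},\mathfrak{t})$ on $\mathcal{C}$, $\mathcal{P}_{\mathbb{G}}$ (resp. $\mathcal{I}_{\mathbb{G}}$) is the ideal of morphisms $f$ with $\mathbb{G}(f,-)=0$ (resp. $\mathbb{G}(-,f)=0$). $\mathbb{G}$ induces a functor $(\mathcal{C}/\mathcal{P}_{\mathbb{G}})^{\rm op}\times(\mathcal{C}/\mathcal{I}_{\mathbb{G}})\to\mathrm{Mod}R$. A right Auslander–Reiten–Serre (ARS) duality on $(\mathcal{C},\mathbb{G},\mathfrak{t})$ is a pair $(\tau,\eta)$ of an $R$-linear functor $\tau:\mathcal{C}/\mathcal{P}_{\mathbb{G}}\to\mathcal{C}/\mathcal{I}_{\mathbb{G}}$ and a binatural isomorphism of $R$-modules $\eta_{A,B}:(\mathcal{C}/\mathcal{P}_{\mathbb{G}})(A,B)\simeq\mathbb{D}\mathbb{G}(B,\tau A)$. Write $\underline{\mathcal{C}}=\mathcal{C}/\mathcal{P}_{\mathbb{E}}$, $\overline{\mathcal{C}}=\mathcal{C}/\mathcal{I}_{\mathbb{E}}$. Since $\mathcal{P}_{\mathbb{E}}\subseteq\mathcal{P}_{\mathbb{F}}$ and $\mathcal{I}_{\mathbb{E}}\subseteq\mathcal{I}_{\mathbb{F}}$, there are canonical functors $\pi,\pi'$, which are the identity on objects; the equality $\pi'\tau=\tau_{\mathbb{F}}\pi$ in particular means $\tau_{\mathbb{F}}A=\tau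 A$ on objects. *)

(* Defs.v *)
From HB Require Import structures.
From mathcomp Require Import all_boot all_order all_algebra.
From mathcomp Require Import generic_quotient ring_quotient boolp.

Set Implicit Arguments.
Unset Strict Implicit.
Unset Printing Implicit Defensive.

Import GRing.Theory.
Local Open Scope ring_scope.
Local Open Scope quotient_scope.

Definition fin_gen (R : pzRingType) (M : lmodType R) : Prop :=
  exists (n : nat) (g : 'I_n -> M),
    forall m : M, exists c : 'I_n -> R, m = \sum_i c i *: g i.

(* Ideals of [R] are the submodules of the regular module [R^o]; all subsets
   are boolean predicates here, classically. *)
Definition artinian (R : comPzRingType) : Prop :=
  forall I : nat -> submodClosed R^o,
    (forall n, {subset I n.+1 <= I n}) ->
    exists N : nat, forall n, (N <= n)%N -> I n =i I N.

Section ModR.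
Variable R : comPzRingType.

(* Monomorphisms of finitely generated modules over an artin (hence noetherian)
   ring are the injective linear maps. *)
Definition injective_modR (J : lmodType R) : Prop :=
  forall (M N : lmodType R) (i : {linear M -> N}) (f : {linear M -> J}),
    fin_gen M -> fin_gen N -> injective i ->
    exists g : {linear N -> J}, forall x, g (i x) = f x.

Definition cogenerator_modR (J : lmodType R) : Prop :=
  forall (M N : lmodType R) (f g : {linear M -> N}),
    fin_gen M -> fin_gen N ->
    (forall h : {linear N -> J}, h \o f =1 h \o g) -> f =1 g.

Definition injective_cogenerator_modR (J : lmodType R) : Prop :=
  [/\ fin_gen J, injective_modR J & cogenerator_modR J].

(* Minimality is with respect to embeddings, which split because [J] is
   injective. *)
Definition minimal_injective_cogenerator (J : lmodType R) : Prop :=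
  injective_cogenerator_modR J /\
  forall K : lmodType R, injective_cogenerator_modR K ->
    exists i : {linear J -> K}, injective i.

End ModR.

Definition dual_mod (R : comPzRingType) (J M : lmodType R) := {linear M -> J}.

Section Dual.
Variables (R : comPzRingType) (J : lmodType R).

Section DualModule.
Variable M : lmodType R.
Implicit Types f g h : dual_mod J M.

Lemma dual_ext f g : f =1 g -> f = g.
Proof.
case: f g => [f cf] [g cg] /= fg.
have E : f = g by apply/funext => x; exact: fg.
case: _ / E cg {fg} => cg; congr GRing.Linear.Pack.
case: cf cg => [[f1] [f2]] [[g1] [g2]].
by rewrite (Prop_irrelevance f1 g1) (Prop_irrelevance f2 g2).
Qed.

HB.instance Definition _ := gen_eqMixin (dual_mod J M).
HB.instance Definition _ := gen_choiceMixin (dual_mod J M).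

Definition dual_zero : dual_mod J M := \0.
Definition dual_add f g : dual_mod J M := f \+ g.
Definition dual_opp f : dual_mod J M := \- f.
Definition dual_scale (a : R) f : dual_mod J M := a \*: f.

Lemma dual_addA : associative dual_add.
Proof. by move=> f g h; apply: dual_ext => x /=; rewrite addrA. Qed.
Lemma dual_addC : commutative dual_add.
Proof. by move=> f g; apply: dual_ext => x /=; rewrite addrC. Qed.
Lemma dual_add0 : left_id dual_zero dual_add.
Proof. by move=> f; apply: dual_ext => x /=; rewrite add0r. Qed.
Lemma dual_addN : left_inverse dual_zero dual_opp dual_add.
Proof. by move=> f; apply: dual_ext => x /=; rewrite addNr. Qed.

HB.instance Definition _ :=
  GRing.isZmodule.Build (dual_mod J M) dual_addA dual_addC dual_add0 dual_addN.

Lemma dual_scaleA a b f : dual_scale a (dual_scale b f) = dual_scale (a * b) f.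
Proof. by apply: dual_ext => x /=; rewrite scalerA. Qed.
Lemma dual_scale1 : left_id 1 dual_scale.
Proof. by move=> f; apply: dual_ext => x /=; rewrite scale1r. Qed.
Lemma dual_scaleDr : right_distributive dual_scale +%R.
Proof. by move=> a f g; apply: dual_ext => x /=; rewrite scalerDr. Qed.
Lemma dual_scaleDl f : {morph dual_scale^~ f : a b / a + b}.
Proof. by move=> a b; apply: dual_ext => x /=; rewrite scalerDl. Qed.

HB.instance Definition _ := GRing.Zmodule_isLmodule.Build R (dual_mod J M)
  dual_scaleA dual_scale1 dual_scaleDr dual_scaleDl.

End DualModule.

Definition dual_map (M N : lmodType R) (f : {linear M -> N})
  (phi : dual_mod J N) : dual_mod J M := phi \o f.

End Dual.

Section QuotientModule.
Variables (R : pzRingType) (V : lmodType R) (U : submodClosed V).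

Lemma submod_zmod_closed : zmod_closed U.
Proof. by apply: GRing.submod_closedB; exact: GRing.submodClosedP. Qed.

Definition submod_zmod : zmodClosed V :=
  HB.pack (GRing.SubmodClosed.sort U)
    (GRing.isZmodClosed.Build V _ submod_zmod_closed).

Definition quot_mod := Quotient.quot submod_zmod.

HB.instance Definition _ := GRing.Zmodule.on quot_mod.
HB.instance Definition _ := EqQuotient.on quot_mod.

Lemma quot_mod_eqP (x y : V) :
  reflect (\pi_quot_mod x = \pi_quot_mod y) (x - y \in U).
Proof.
by rewrite [_ \in U](Quotient.idealrBE submod_zmod x y); apply: eqP.
Qed.

Lemma quot_mod_piD x y : \pi_quot_mod (x + y) = \pi_quot_mod x + \pi_quot_mod y.
Proof. exact: Quotient.pi_add. Qed.

Definition quot_scale (a : R) (x : quot_mod) : quot_mod :=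
  \pi_quot_mod (a *: repr x).

Lemma quot_scale_pi a x : quot_scale a (\pi_quot_mod x) = \pi_quot_mod (a *: x).
Proof.
apply/quot_mod_eqP; rewrite -scalerBr rpredZ //.
by apply/quot_mod_eqP; rewrite reprK.
Qed.

Lemma quot_scaleA a b x : quot_scale a (quot_scale b x) = quot_scale (a * b) x.
Proof.
rewrite -[x]reprK (quot_scale_pi b (repr x)) (quot_scale_pi a (b *: repr x)).
by rewrite (quot_scale_pi (a * b) (repr x)) scalerA.
Qed.
Lemma quot_scale1 : left_id 1 quot_scale.
Proof. by move=> x; rewrite -[x]reprK quot_scale_pi scale1r. Qed.
Lemma quot_scaleDr : right_distributive quot_scale +%R.
Proof.
move=> a x y; rewrite -[x]reprK -[y]reprK -quot_mod_piD !quot_scale_pi.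
by rewrite -quot_mod_piD scalerDr.
Qed.
Lemma quot_scaleDl x : {morph quot_scale^~ x : a b / a + b}.
Proof.
by move=> a b; rewrite -[x]reprK !quot_scale_pi -quot_mod_piD scalerDl.
Qed.

HB.instance Definition _ := GRing.Zmodule_isLmodule.Build R quot_mod
  quot_scaleA quot_scale1 quot_scaleDr quot_scaleDl.

Lemma quot_mod_piP a x y :
  \pi_quot_mod (a *: x + y) = a *: \pi_quot_mod x + \pi_quot_mod y.
Proof. by rewrite quot_mod_piD -quot_scale_pi. Qed.

End QuotientModule.

Record lin_category (R : comPzRingType) := LinCategory {
  obj :> Type;
  mor : obj -> obj -> lmodType R;
  idm : forall A, mor A A;
  mcomp : forall A B C, mor B C -> mor A B -> mor A C;
  comp_idl : forall A B (f : mor A B), mcomp (idm B) f = f;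
  comp_idr : forall A B (f : mor A B), mcomp f (idm A) = f;
  comp_assoc : forall A B C D (h : mor C D) (g : mor B C) (f : mor A B),
    mcomp h (mcomp g f) = mcomp (mcomp h g) f;
  comp_linl : forall A B C (f : mor A B) a (g g' : mor B C),
    mcomp (a *: g + g') f = a *: mcomp g f + mcomp g' f;
  comp_linr : forall A B C (g : mor B C) a (f f' : mor A B),
    mcomp g (a *: f + f') = a *: mcomp g f + mcomp g f' }.

Arguments mor {R l}.
Arguments idm {R l}.
Arguments mcomp {R l A B C}.

Notation "g \oc f" := (mcomp g f) (at level 40, left associativity).

Section Category.
Variables (R : comPzRingType) (C : lin_category R).

Lemma comp_subl (A B B' : C) (f : mor A B) (g g' : mor B B') :
  (g - g') \oc f = g \oc f - g' \oc f.
Proof. by rewrite addrC -scaleN1r comp_linl scaleN1r addrC. Qed.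

Lemma comp_subr (A B B' : C) (g : mor B B') (f f' : mor A B) :
  g \oc (f - f') = g \oc f - g \oc f'.
Proof. by rewrite addrC -scaleN1r comp_linr scaleN1r addrC. Qed.

Definition is_iso (A B : C) (f : mor A B) : Prop :=
  exists g : mor B A, g \oc f = idm A /\ f \oc g = idm B.

Definition zero_object (Z : C) : Prop := idm Z = 0.

Record biproduct (A B P : C) (iA : mor A P) (iB : mor B P)
    (pA : mor P A) (pB : mor P B) : Prop := Biproduct {
  biproduct_AA : pA \oc iA = idm A;
  biproduct_BB : pB \oc iB = idm B;
  biproduct_AB : pB \oc iA = 0;
  biproduct_BA : pA \oc iB = 0;
  biproduct_sum : iA \oc pA + iB \oc pB = idm P }.

Definition additive_category : Prop :=
  (exists Z : C, zero_object Z) /\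
  (forall A B : C, exists (P : C) (iA : mor A P) (iB : mor B P)
     (pA : mor P A) (pB : mor P B), biproduct iA iB pA pB).

End Category.

(* The action on objects is a parameter, so that functors with the same object
   map can be compared without transport. *)
Record lin_functor (R : comPzRingType) (C D : lin_category R)
    (F : C -> D) := LinFunctor {
  fmap : forall A B : C, {linear mor A B -> mor (F A) (F B)};
  fmap_id : forall A, fmap A A (idm A) = idm (F A);
  fmap_comp : forall A B B' (g : mor B B') (f : mor A B),
    fmap A B' (g \oc f) = fmap B B' g \oc fmap A B f }.

Arguments fmap {R C D F} l {A B}.

Section FunctorComp.
Variables (R : comPzRingType) (C D E : lin_category R).
Variables (F : C -> D) (G : D -> E).
Variables (GG : lin_functor G) (FF : lin_functor F).

Definition functor_comp_map (A B : C) :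
  {linear mor A B -> mor (G (F A)) (G (F B))} := fmap GG \o fmap FF.

Lemma functor_comp_id A : functor_comp_map A A (idm A) = idm (G (F A)).
Proof. by rewrite /= !fmap_id. Qed.
Lemma functor_comp_comp A B B' (g : mor B B') (f : mor A B) :
  functor_comp_map A B' (g \oc f) =
  functor_comp_map B B' g \oc functor_comp_map A B f.
Proof. by rewrite /= !fmap_comp. Qed.

Definition functor_comp : lin_functor (fun A => G (F A)) :=
  LinFunctor functor_comp_id functor_comp_comp.

End FunctorComp.

Record ideal (R : comPzRingType) (C : lin_category R) := Ideal {
  ideal_mem :> forall A B : C, submodClosed (mor A B);
  ideal_compl : forall A B B' (g : mor B B') (f : mor A B),
    f \in ideal_mem A B -> g \oc f \in ideal_mem A B';
  ideal_compr : forall A' A B (f : mor A B) (e : mor A' A),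
    f \in ideal_mem A B -> f \oc e \in ideal_mem A' B }.

Section QuotientCategory.
Variables (R : comPzRingType) (C : lin_category R) (I : ideal C).

Definition quot_mor (A B : C) : lmodType R := quot_mod (I A B).

Definition quot_class (A B : C) (f : mor A B) : quot_mor A B := \pi f.

Lemma quot_classP (A B : C) (f g : mor A B) :
  quot_class f = quot_class g <-> f - g \in I A B.
Proof. by split=> /quot_mod_eqP. Qed.

Lemma quot_class_lin (A B : C) a (f g : mor A B) :
  quot_class (a *: f + g) = a *: quot_class f + quot_class g.
Proof. exact: quot_mod_piP. Qed.

Lemma quot_reprK (A B : C) (f : quot_mor A B) : quot_class (repr f) = f.
Proof. exact: reprK. Qed.

Lemma quot_mor_ind (A B : C) (P : quot_mor A B -> Prop) :
  (forall f : mor A B, P (quot_class f)) -> forall f, P f.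
Proof. by move=> Pc f; rewrite -[f]quot_reprK; apply: Pc. Qed.

Lemma quot_repr (A B : C) (f : mor A B) : repr (quot_class f) - f \in I A B.
Proof. by apply/quot_classP; rewrite quot_reprK. Qed.

Definition quot_comp A B B' (g : quot_mor B B') (f : quot_mor A B) :
  quot_mor A B' := quot_class (repr g \oc repr f).

Lemma quot_compE (A B B' : C) (g : mor B B') (f : mor A B) :
  quot_comp (quot_class g) (quot_class f) = quot_class (g \oc f).
Proof.
apply/quot_classP; set g' := repr _; set f' := repr _.
have -> : g' \oc f' - g \oc f = (g' - g) \oc f' + g \oc (f' - f).
  by rewrite comp_subl comp_subr addrA subrK.
by apply: rpredD; [apply: ideal_compr | apply: ideal_compl]; apply: quot_repr.
Qed.

Lemma quot_comp_idl A B (f : quot_mor A B) :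
  quot_comp (quot_class (idm B)) f = f.
Proof. by elim/quot_mor_ind: f => f; rewrite (quot_compE _ f) comp_idl. Qed.

Lemma quot_comp_idr A B (f : quot_mor A B) :
  quot_comp f (quot_class (idm A)) = f.
Proof. by elim/quot_mor_ind: f => f; rewrite (quot_compE f) comp_idr. Qed.

Lemma quot_comp_assoc A B B' B'' (h : quot_mor B' B'') (g : quot_mor B B')
    (f : quot_mor A B) :
  quot_comp h (quot_comp g f) = quot_comp (quot_comp h g) f.
Proof.
elim/quot_mor_ind: h => h; elim/quot_mor_ind: g => g.
elim/quot_mor_ind: f => f.
rewrite (quot_compE g f) (quot_compE h g) (quot_compE h (g \oc f)).
by rewrite (quot_compE (h \oc g) f) comp_assoc.
Qed.

Lemma quot_comp_linl A B B' (f : quot_mor A B) a (g g' : quot_mor B B') :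
  quot_comp (a *: g + g') f = a *: quot_comp g f + quot_comp g' f.
Proof.
elim/quot_mor_ind: f => f; elim/quot_mor_ind: g => g.
elim/quot_mor_ind: g' => g'.
rewrite -quot_class_lin (quot_compE g f) (quot_compE g' f).
by rewrite (quot_compE (a *: g + g') f) comp_linl quot_class_lin.
Qed.

Lemma quot_comp_linr A B B' (g : quot_mor B B') a (f f' : quot_mor A B) :
  quot_comp g (a *: f + f') = a *: quot_comp g f + quot_comp g f'.
Proof.
elim/quot_mor_ind: g => g; elim/quot_mor_ind: f => f.
elim/quot_mor_ind: f' => f'.
rewrite -quot_class_lin (quot_compE g f) (quot_compE g f').
by rewrite (quot_compE g (a *: f + f')) comp_linr quot_class_lin.
Qed.

Definition quot_category : lin_category R :=
  LinCategory quot_comp_idl quot_comp_idr quot_comp_assoc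
    quot_comp_linl quot_comp_linr.

End QuotientCategory.

Section CanonicalFunctor.
Variables (R : comPzRingType) (C : lin_category R) (I J : ideal C).
Hypothesis IJ : forall A B : C, {subset I A B <= J A B}.

Definition quot_proj A B (f : @mor R (quot_category I) A B) :
  @mor R (quot_category J) A B := quot_class J (repr f).

Lemma quot_projE A B (f : mor A B) :
  quot_proj (quot_class I f) = quot_class J f.
Proof. by apply/quot_classP; apply: IJ; apply: quot_repr. Qed.

Lemma quot_proj_linear A B : linear (@quot_proj A B).
Proof.
move=> a f g; rewrite -[f]quot_reprK -[g]quot_reprK -quot_class_lin.
by rewrite !quot_projE quot_class_lin.
Qed.

HB.instance Definition _ A B :=
  GRing.isLinear.Build R _ _ _ (@quot_proj A B) (@quot_proj_linear A B).

Definition quot_projL A B :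
  {linear @mor R (quot_category I) A B -> @mor R (quot_category J) A B} :=
  @quot_proj A B.

Lemma quot_proj_id A :
  quot_projL A A (@idm R (quot_category I) A) = @idm R (quot_category J) A.
Proof. exact: quot_projE. Qed.
Lemma quot_proj_comp A B B' (g : @mor R (quot_category I) B B')
    (f : @mor R (quot_category I) A B) :
  quot_projL A B' (g \oc f) = quot_projL B B' g \oc quot_projL A B f.
Proof.
rewrite -[g]quot_reprK -[f]quot_reprK /= quot_compE !quot_projE.
by rewrite quot_compE.
Qed.

(* The canonical functor C/I -> C/J for ideals I contained in J. *)
Definition quot_functor :
  @lin_functor R (quot_category I) (quot_category J) (fun A => A) :=
  LinFunctor quot_proj_id quot_proj_comp.

End CanonicalFunctor.

(* R-bilinear functors C^op x D -> Mod R; [ext X A] is contravariant in [X]. *)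
Record bifunctor (R : comPzRingType) (C D : lin_category R) := Bifunctor {
  ext :> C -> D -> lmodType R;
  pull : forall (X X' : C) (A : D), mor X' X -> {linear ext X A -> ext X' A};
  push : forall (X : C) (A A' : D), mor A A' -> {linear ext X A -> ext X A'};
  pull_id : forall X A (d : ext X A), pull A (idm X) d = d;
  push_id : forall X A (d : ext X A), push X (idm A) d = d;
  pull_comp : forall X X' X'' A (c : mor X' X) (c' : mor X'' X')
    (d : ext X A), pull A (c \oc c') d = pull A c' (pull A c d);
  push_comp : forall X A A' A'' (a : mor A A') (a' : mor A' A'')
    (d : ext X A), push X (a' \oc a) d = push X a' (push X a d);
  pull_push : forall X X' A A' (c : mor X' X) (a : mor A A') (d : ext X A),
    pull A' c (push X a d) = push X' a (pull A c d);
  pull_lin : forall X X' A r (c c' : mor X' X) (d : ext X A),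
    pull A (r *: c + c') d = r *: pull A c d + pull A c' d;
  push_lin : forall X A A' r (a a' : mor A A') (d : ext X A),
    push X (r *: a + a') d = r *: push X a d + push X a' d }.

Arguments pull {R C D} b {X X' A}.
Arguments push {R C D} b {X A A'}.

Section Subfunctor.
Variables (R : comPzRingType) (C : lin_category R) (F E : bifunctor C C).

(* A subfunctor of [E], given by a natural monomorphism [F -> E]. *)
Record subfunctor := Subfunctor {
  incl : forall X A : C, {linear F X A -> E X A};
  incl_inj : forall X A, injective (incl X A);
  incl_pull : forall X X' A (c : mor X' X) (d : F X A),
    incl X' A (pull F c d) = pull E c (incl X A d);
  incl_push : forall X A A' (a : mor A A') (d : F X A),
    incl X A' (push F a d) = push E a (incl X A d) }.

End Subfunctor.

Arguments incl {R C F E} s {X A}.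

(* [s d x y] holds when the sequence A -x-> B -y-> X belongs to the class
   attached to [d : E X A]. *)
Definition realization (R : comPzRingType) (C : lin_category R)
    (E : bifunctor C C) : Type :=
  forall (X A : C) (d : E X A) (B : C), mor A B -> mor B X -> Prop.

Section Extriangulated.
Variables (R : comPzRingType) (C : lin_category R) (E : bifunctor C C).

Definition seq_equiv (A X B B' : C) (x : mor A B) (y : mor B X)
    (x' : mor A B') (y' : mor B' X) : Prop :=
  exists b : mor B B', [/\ is_iso b, b \oc x = x' & y' \oc b = y].

Definition ext_morphism (X A X' A' : C) (d : E X A) (d' : E X' A')
    (a : mor A A') (c : mor X X') : Prop :=
  push E a d = pull E c d'.

Variable s : realization E.

(* [s d] is one equivalence class of sequences. *)
Definition realization_class : Prop :=
  forall (X A : C) (d : E X A),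
    (exists (B : C) (x : mor A B) (y : mor B X), s d x y) /\
    (forall (B B' : C) (x : mor A B) (y : mor B X)
       (x' : mor A B') (y' : mor B' X),
       s d x y -> (s d x' y' <-> seq_equiv x y x' y')).

Definition realization_morphisms : Prop :=
  forall (X A X' A' : C) (d : E X A) (d' : E X' A')
    (B B' : C) (x : mor A B) (y : mor B X) (x' : mor A' B') (y' : mor B' X')
    (a : mor A A') (c : mor X X'),
    s d x y -> s d' x' y' -> ext_morphism d d' a c ->
    exists b : mor B B', b \oc x = x' \oc a /\ y' \oc b = c \oc y.

Definition realization_zero : Prop :=
  forall (A X P : C) (iA : mor A P) (iX : mor X P)
    (pA : mor P A) (pX : mor P X),
    biproduct iA iX pA pX -> s (0 : E X A) iA pX.

(* The element of E (X (+) X') (A (+) A') with diagonal components [d], [d']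
   and zero off-diagonal components. *)
Definition ext_sum (X A X' A' PX PA : C) (pX : mor PX X) (pX' : mor PX X')
    (iA : mor A PA) (iA' : mor A' PA) (d : E X A) (d' : E X' A') : E PX PA :=
  push E iA (pull E pX d) + push E iA' (pull E pX' d').

Definition mor_sum (A A' B B' PA PB : C) (pA : mor PA A) (pA' : mor PA A')
    (iB : mor B PB) (iB' : mor B' PB) (f : mor A B) (f' : mor A' B') :
  mor PA PB := iB \oc f \oc pA + iB' \oc f' \oc pA'.

Definition realization_sum : Prop :=
  forall (X A X' A' B B' : C) (d : E X A) (d' : E X' A')
    (x : mor A B) (y : mor B X) (x' : mor A' B') (y' : mor B' X')
    (PA PB PX : C)
    (iA : mor A PA) (iA' : mor A' PA) (pA : mor PA A) (pA' : mor PA A')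
    (iB : mor B PB) (iB' : mor B' PB) (pB : mor PB B) (pB' : mor PB B')
    (iX : mor X PX) (iX' : mor X' PX) (pX : mor PX X) (pX' : mor PX X'),
    biproduct iA iA' pA pA' -> biproduct iB iB' pB pB' ->
    biproduct iX iX' pX pX' ->
    s d x y -> s d' x' y' ->
    s (ext_sum pX pX' iA iA' d d')
      (mor_sum pA pA' iB iB' x x') (mor_sum pB pB' iX iX' y y').

Record additive_realization : Prop := AdditiveRealization {
  realization_is_class : realization_class;
  realization_extends : realization_morphisms;
  realization_0 : realization_zero;
  realization_D : realization_sum }.

Definition ET3 : Prop :=
  forall (X A X' A' : C) (d : E X A) (d' : E X' A')
    (B B' : C) (x : mor A B) (y : mor B X) (x' : mor A' B') (y' : mor B' X')
    (a : mor A A') (b : mor B B'),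
    s d x y -> s d' x' y' -> b \oc x = x' \oc a ->
    exists c : mor X X', c \oc y = y' \oc b /\ ext_morphism d d' a c.

Definition ET3op : Prop :=
  forall (X A X' A' : C) (d : E X A) (d' : E X' A')
    (B B' : C) (x : mor A B) (y : mor B X) (x' : mor A' B') (y' : mor B' X')
    (b : mor B B') (c : mor X X'),
    s d x y -> s d' x' y' -> c \oc y = y' \oc b ->
    exists a : mor A A', b \oc x = x' \oc a /\ ext_morphism d d' a c.

Definition ET4 : Prop :=
  forall (A B X D F : C) (d1 : E D A) (d2 : E F B)
    (f : mor A B) (f' : mor B D) (g : mor B X) (g' : mor X F),
    s d1 f f' -> s d2 g g' ->
    exists (Y : C) (d : mor D Y) (e : mor Y F) (h' : mor X Y) (d3 : E Y A),
      [/\ s d3 (g \oc f) h',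
          h' \oc g = d \oc f' /\ e \oc h' = g',
          s (push E f' d2) d e,
          pull E d d3 = d1 &
          push E f d3 = pull E e d2].

Definition ET4op : Prop :=
  forall (A B X D F : C) (d1 : E B D) (d2 : E X F)
    (f' : mor D A) (f : mor A B) (g' : mor F B) (g : mor B X),
    s d1 f' f -> s d2 g' g ->
    exists (Y : C) (d : mor D Y) (e : mor Y F) (h' : mor Y A) (d3 : E X Y),
      [/\ s d3 h' (g \oc f),
          h' \oc d = f' /\ f \oc h' = g' \oc e,
          s (pull E g' d1) d e,
          push E e d3 = d2 &
          push E d d1 = pull E g d3].

Record extriangulated : Prop := Extriangulated {
  extriangulated_additive : additive_category C;
  extriangulated_realization : additive_realization;
  extriangulated_ET3 : ET3;
  extriangulated_ET3op : ET3op;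
  extriangulated_ET4 : ET4;
  extriangulated_ET4op : ET4op }.

Definition ext_finite : Prop := forall X A : C, fin_gen (E X A).

End Extriangulated.

Definition restrict_realization (R : comPzRingType) (C : lin_category R)
    (F E : bifunctor C C) (iota : subfunctor F E) (s : realization E) :
  realization F := fun X A d B x y => s X A (incl iota d) B x y.

Definition closed_subfunctor (R : comPzRingType) (C : lin_category R)
    (F E : bifunctor C C) (iota : subfunctor F E) (s : realization E) : Prop :=
  extriangulated (restrict_realization iota s).

Section Stable.
Variables (R : comPzRingType) (C : lin_category R) (G : bifunctor C C).

(* P_G = {f | G(f, -) = 0} and I_G = {f | G(-, f) = 0}. *)
Definition proj_pred (A B : C) (f : mor A B) : bool :=
  `[< forall (X : C) (d : G B X), pull G f d = 0 >].

Definition inj_pred (A B : C) (f : mor A B) : bool :=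
  `[< forall (X : C) (d : G X A), push G f d = 0 >].

Lemma pull0 (X X' A : C) (d : G X A) : pull G (0 : mor X' X) d = 0.
Proof.
by have := pull_lin (-1) (0 : mor X' X) 0 d; rewrite !scaleN1r !addNr.
Qed.

Lemma push0 (X A A' : C) (d : G X A) : push G (0 : mor A A') d = 0.
Proof.
by have := push_lin (-1) (0 : mor A A') 0 d; rewrite !scaleN1r !addNr.
Qed.

Lemma proj_closed (A B : C) : submod_closed (@proj_pred A B).
Proof.
split=> [|a f g /asboolP f0 /asboolP g0]; apply/asboolP => X d.
  by rewrite pull0.
by rewrite pull_lin f0 g0 scaler0 addr0.
Qed.

Lemma inj_closed (A B : C) : submod_closed (@inj_pred A B).
Proof.
split=> [|a f g /asboolP f0 /asboolP g0]; apply/asboolP => X d.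
  by rewrite push0.
by rewrite push_lin f0 g0 scaler0 addr0.
Qed.

Definition proj_mem (A B : C) : submodClosed (mor A B) :=
  HB.pack (@proj_pred A B)
    (GRing.isSubmodClosed.Build R _ (@proj_pred A B) (proj_closed A B)).

Definition inj_mem (A B : C) : submodClosed (mor A B) :=
  HB.pack (@inj_pred A B)
    (GRing.isSubmodClosed.Build R _ (@inj_pred A B) (inj_closed A B)).

Lemma proj_memP (A B : C) (f : mor A B) :
  reflect (forall (X : C) (d : G B X), pull G f d = 0) (f \in proj_mem A B).
Proof. exact: asboolP. Qed.

Lemma inj_memP (A B : C) (f : mor A B) :
  reflect (forall (X : C) (d : G X A), push G f d = 0) (f \in inj_mem A B).
Proof. exact: asboolP. Qed.

Lemma proj_compl (A B B' : C) (g : mor B B') (f : mor A B) :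
  f \in proj_mem A B -> g \oc f \in proj_mem A B'.
Proof. by move=> /proj_memP f0; apply/proj_memP => X d; rewrite pull_comp. Qed.
Lemma proj_compr (A' A B : C) (f : mor A B) (e : mor A' A) :
  f \in proj_mem A B -> f \oc e \in proj_mem A' B.
Proof.
by move=> /proj_memP f0; apply/proj_memP => X d; rewrite pull_comp f0 linear0.
Qed.
Lemma inj_compl (A B B' : C) (g : mor B B') (f : mor A B) :
  f \in inj_mem A B -> g \oc f \in inj_mem A B'.
Proof.
by move=> /inj_memP f0; apply/inj_memP => X d; rewrite push_comp f0 linear0.
Qed.
Lemma inj_compr (A' A B : C) (f : mor A B) (e : mor A' A) :
  f \in inj_mem A B -> f \oc e \in inj_mem A' B.
Proof. by move=> /inj_memP f0; apply/inj_memP => X d; rewrite push_comp. Qed.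

Definition proj_ideal : ideal C := Ideal proj_compl proj_compr.
Definition inj_ideal : ideal C := Ideal inj_compl inj_compr.

Definition proj_stable : lin_category R := quot_category proj_ideal.
Definition inj_stable : lin_category R := quot_category inj_ideal.

Definition stable_pull (X X' : proj_stable) (A : inj_stable)
  (c : mor X' X) : {linear G X A -> G X' A} := pull G (repr c).
Definition stable_push (X : proj_stable) (A A' : inj_stable)
  (a : mor A A') : {linear G X A -> G X A'} := push G (repr a).

Lemma stable_pullE (X X' A : C) (c : mor X' X) :
  @stable_pull X X' A (quot_class proj_ideal c) =1 pull G c.
Proof.
move=> d; have /proj_memP/(_ _ d) := quot_repr proj_ideal c.
rewrite addrC -scaleN1r pull_lin scaleN1r addrC => /eqP.
by rewrite subr_eq0 => /eqP.
Qed.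

Lemma stable_pushE (X A A' : C) (a : mor A A') :
  @stable_push X A A' (quot_class inj_ideal a) =1 push G a.
Proof.
move=> d; have /inj_memP/(_ _ d) := quot_repr inj_ideal a.
rewrite addrC -scaleN1r push_lin scaleN1r addrC => /eqP.
by rewrite subr_eq0 => /eqP.
Qed.

Definition stable_ext : bifunctor proj_stable inj_stable.
Proof.
apply: (@Bifunctor R proj_stable inj_stable G stable_pull stable_push).
- by move=> X A d; rewrite stable_pullE pull_id.
- by move=> X A d; rewrite stable_pushE push_id.
- move=> X X' X'' A c c' d; rewrite -[c]quot_reprK -[c']quot_reprK /= quot_compE.
  by rewrite !stable_pullE pull_comp.
- move=> X A A' A'' a a' d; rewrite -[a]quot_reprK -[a']quot_reprK /= quot_compE.
  by rewrite !stable_pushE push_comp.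
- by move=> X X' A A' c a d; apply: pull_push.
- move=> X X' A r c c' d; rewrite -[c]quot_reprK -[c']quot_reprK.
  by rewrite -quot_class_lin !stable_pullE pull_lin.
- move=> X A A' r a a' d; rewrite -[a]quot_reprK -[a']quot_reprK.
  by rewrite -quot_class_lin !stable_pushE push_lin.
Defined.

(* A right ARS duality whose functor acts on objects as [tau0]. *)
Record right_ARS_duality (J : lmodType R) (tau0 : C -> C) := RightARS {
  ars_tau : @lin_functor R proj_stable inj_stable tau0;
  ars_eta : forall A B : proj_stable,
    {linear mor A B -> dual_mod J (stable_ext B (tau0 A))};
  ars_eta_bij : forall A B, bijective (ars_eta A B);
  ars_eta_natural : forall (A A' B B' : proj_stable)
    (a : mor A' A) (b : mor B B') (f : mor A B)
    (d : stable_ext B' (tau0 A')),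
    ars_eta A' B' (b \oc f \oc a) d =
    ars_eta A B f (pull stable_ext b (push stable_ext (fmap ars_tau a) d)) }.

End Stable.

Arguments ars_tau {R C G J tau0} r.
Arguments ars_eta {R C G J tau0} r {A B}.

Section RelativeStable.
Variables (R : comPzRingType) (C : lin_category R) (F E : bifunctor C C).
Variable iota : subfunctor F E.

Lemma proj_ideal_sub (A B : C) :
  {subset proj_ideal E A B <= proj_ideal F A B}.
Proof.
move=> f /proj_memP f0; apply/proj_memP => X d.
by apply: (@incl_inj _ _ _ _ iota); rewrite incl_pull f0 linear0.
Qed.

Lemma inj_ideal_sub (A B : C) :
  {subset inj_ideal E A B <= inj_ideal F A B}.
Proof.
move=> f /inj_memP f0; apply/inj_memP => X d.
by apply: (@incl_inj _ _ _ _ iota); rewrite incl_push f0 linear0.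
Qed.

Definition proj_functor :
  @lin_functor R (proj_stable E) (proj_stable F) (fun A => A) :=
  quot_functor proj_ideal_sub.

Definition inj_functor :
  @lin_functor R (inj_stable E) (inj_stable F) (fun A => A) :=
  quot_functor inj_ideal_sub.

End RelativeStable.

(* Main.v *)
Require Import Defs.
From HB Require Import structures.
From mathcomp Require Import all_boot all_order all_algebra.
From mathcomp Require Import generic_quotient boolp.

Set Implicit Arguments.
Unset Strict Implicit.
Unset Printing Implicit Defensive.

Import GRing.Theory.
Local Open Scope ring_scope.
Local Open Scope quotient_scope.

(** A morphism [f : A -> B] lies in P_F exactly when the functional [eta f]
    vanishes on F(B, tau A). One direction is [eta f d = eta 1 (f^* d)].
    Conversely, let [X -> Y -y-> B] realize [d] in F(B, X). The kernel of
    [y^* : E(B, tau A) -> E(Y, tau A)] consists of pushforwards of [d], hence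
    lies in F, so [eta f] factors through [y^*] by injectivity of [J]; as [eta]
    is onto, [f = y g] modulo P_E, and [f^* d = g^* y^* d = 0].

    Thus [eta] descends to an injective map, which is onto because functionals
    on F(B, tau A) extend to E(B, tau A). If [a] is in P_F, then so is every
    [f a], so all functionals kill [(tau a)_* d] for [d] in F; as [J]
    cogenerates, [tau a] is in I_F, and [tau] descends too.

    Modules F(B, X) are finitely generated since artinian rings are noetherian:
    a minimal non-finitely generated ideal [I] would be a vector space over
    R/ann I, and such a space, of infinite dimension, has a proper subspace of
    infinite dimension. *)

(** * Finitely generated modules through lists of generators *)

Section FinitelyGenerated.
Variable R : comPzRingType.

Definition is_submod (M : lmodType R) (U : M -> Prop) : Prop :=
  U 0 /\ forall a x y, U x -> U y -> U (a *: x + y).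

(** Recursion on the list peels off one generator at a time, so that spans are handled by induction
    instead of indexed sums. *)
Fixpoint span (M : lmodType R) (s : seq M) (m : M) : Prop :=
  if s is g :: s' then exists c : R, span s' (m - c *: g) else m = 0.

Definition fg_sub (M : lmodType R) (U : M -> Prop) : Prop :=
  exists s : seq M, forall m, U m <-> span s m.

Section Submodules.
Variables (M : lmodType R) (U : M -> Prop).
Hypothesis Usub : is_submod U.

Lemma submodD x y : U x -> U y -> U (x + y).
Proof. by case: Usub => _ h Ux Uy; rewrite -[x]scale1r; apply: h. Qed.

Lemma submodZ a x : U x -> U (a *: x).
Proof. by case: Usub => U0 h Ux; rewrite -[a *: x]addr0; apply: h. Qed.

Lemma submodB x y : U x -> U y -> U (x - y).
Proof.
by move=> Ux Uy; apply: submodD => //; rewrite -scaleN1r; apply: submodZ.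
Qed.

Lemma submod_span s : (forall x, x \in s -> U x) ->
  forall m, span s m -> U m.
Proof.
elim: s => [|g s IH] sU m /=; first by move=> ->; case: Usub.
case=> c /IH Um; rewrite -[m](subrK (c *: g)).
apply: submodD; last by apply: submodZ; apply: sU; rewrite mem_head.
by apply: Um => x xs; apply: sU; rewrite inE xs orbT.
Qed.

End Submodules.

Lemma span_submod (M : lmodType R) (s : seq M) : is_submod (span s).
Proof.
elim: s => [|g s [s0 sl]]; split => [|a x y] //=.
- by move=> -> ->; rewrite scaler0 addr0.
- by exists 0; rewrite scale0r subr0.
- case=> c xc [d yd]; exists (a * c + d).
  have -> : a *: x + y - (a * c + d) *: g
            = a *: (x - c *: g) + (y - d *: g).
    by rewrite scalerBr scalerDl scalerA opprD addrACA.
  exact: sl.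
Qed.

Lemma span_cons (M : lmodType R) (g : M) s m : span s m -> span (g :: s) m.
Proof. by move=> sm; exists 0; rewrite scale0r subr0. Qed.

Lemma span_head (M : lmodType R) (g : M) s : span (g :: s) g.
Proof. by exists 1; rewrite scale1r subrr; case: (span_submod s). Qed.

Lemma span_in (M : lmodType R) (s : seq M) m : m \in s -> span s m.
Proof.
elim: s => //= g s IH; rewrite inE => /orP[/eqP->|/IH]; last exact: span_cons.
exact: span_head.
Qed.

Lemma span_cat (M : lmodType R) (s t : seq M) m :
  span (s ++ t) m <-> exists2 x, span s x & span t (m - x).
Proof.
elim: s m => [|g s IH] m /=.
  split=> [tm|[x ->]]; last by rewrite subr0.
  by exists 0; rewrite ?subr0.
split=> [[c /IH[x sx tx]]|[x [c sx] tx]].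
  exists (x + c *: g); first by exists c; rewrite addrK.
  by rewrite opprD addrA addrAC.
exists c; apply/IH; exists (x - c *: g) => //.
by rewrite opprB addrA subrK.
Qed.

(* A linear relation encodes at once the restriction of a linear map to a
   submodule and a map to a quotient, without forming either. *)
Lemma fg_extension (M N : lmodType R) (rho : M -> N -> Prop) :
  rho 0 0 ->
  (forall a x y x' y', rho x y -> rho x' y' ->
     rho (a *: x + x') (a *: y + y')) ->
  fg_sub (fun m => rho m 0) -> fg_sub (fun n => exists m, rho m n) ->
  fg_sub (fun m => exists n, rho m n).
Proof.
move=> r0 rl [s sP] [t tP].
(* [u] lifts the generators [t] of the range; together with the generators [s] of the kernel it
   generates the domain. *)
have [u [uU ut]] : exists u : seq M, (forall x, x \in u -> exists n, rho x n)
    /\ forall n, span t n -> exists2 m, span u m & rho m n.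
  have : forall y, y \in t -> exists m, rho m y.
    by move=> y /span_in /tP.
  elim: t {tP} => [_|g t IH tU].
    by exists [::]; split=> // n /= ->; exists 0.
  have [y yt|u [uU ut]] := IH; first by apply: tU; rewrite inE yt orbT.
  have [x xg] := tU g (mem_head g t).
  exists (x :: u); split=> [z|n [c /ut[m um mn]]].
    by rewrite inE => /orP[/eqP->|/uU //]; exists g.
  exists (c *: x + m); first by exists c; rewrite addrAC subrr add0r.
  by rewrite -[n](subrK (c *: g)) [_ + c *: g]addrC; apply: rl.
have dom : is_submod (fun m => exists n, rho m n).
  split=> [|a x y [n xn] [n' yn]]; first by exists 0.
  by exists (a *: n + n'); apply: rl.
exists (u ++ s) => m; split=> [[n mn]|/span_cat[x ux sx]].
  have [|x ux xn] := ut n; first by apply/tP; exists m.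
  apply/span_cat; exists x => //; apply/sP.
  by have := rl (-1) _ _ _ _ xn mn; rewrite !scaleN1r addNr addrC.
rewrite -[m](subrK x); apply: (submodD dom); first by exists 0; apply/sP.
exact: (submod_span dom uU).
Qed.

Lemma fg_fin_gen (M N : lmodType R) (f : {linear N -> M}) :
  injective f -> fg_sub (fun m => exists n, m = f n) -> fin_gen N.
Proof.
move=> finj [s sP].
have [t ft] : exists t : seq N, map f t = s.
  have : forall x, x \in s -> exists n, x = f n by move=> x /span_in /sP.
  elim: s {sP} => [|g s IH] sU; first by exists [::].
  have [x xs|t <-] := IH; first by apply: sU; rewrite inE xs orbT.
  by have [n ->] := sU g (mem_head g s); exists (n :: t).
exists (size t), (fun i => t`_i) => m.
have : span s (f m) by apply/sP; exists m.
move: m; rewrite -{s sP}ft; elim: t => [|g t IH] m /=.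
  by rewrite -(linear0 f) => /finj ->; exists (fun=> 0); rewrite big_ord0.
case=> c; rewrite -linearZ -linearB => /IH[d md].
exists (fun i => if unlift ord0 i is Some j then d j else c).
rewrite big_ord_recl unlift_none /= -[m](subrK (c *: g)) md addrC.
congr (_ + _); apply: eq_bigr => i _.
by rewrite liftK.
Qed.

Lemma fin_gen_span (M : lmodType R) :
  fin_gen M -> exists s : seq M, forall m, span s m.
Proof.
case=> n [g gP]; exists [seq g i | i <- enum 'I_n] => m.
have [c ->] := gP m.
have S := span_submod [seq g i | i <- enum 'I_n].
apply: (big_ind (span [seq g i | i <- enum 'I_n])).
- by case: S.
- exact: (submodD S).
- move=> i _; apply: (submodZ S); apply: span_in.
  by rewrite map_f ?mem_enum.
Qed.

End FinitelyGenerated.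

(** * Artinian rings are noetherian; submodules of finitely generated modules *)

Section Hopkins.
Variable R : comPzRingType.
Hypothesis artR : artinian R.

Lemma artinian_chain (I : nat -> R^o -> Prop) :
  (forall n, is_submod (I n)) -> (forall n x, I n.+1 x -> I n x) ->
  exists N, forall x, I N x -> I N.+1 x.
Proof.
move=> Isub Idec.
have cl n : submod_closed (fun x : R^o => `[< I n x >]).
  have [I0 Il] := Isub n.
  split=> [|a x y /asboolP Ix /asboolP Iy]; apply/asboolP => //.
  exact: Il.
pose K n : submodClosed R^o := HB.pack (fun x : R^o => `[< I n x >])
    (GRing.isSubmodClosed.Build R _ (fun x : R^o => `[< I n x >]) (cl n)).
have [|N NP] := artR (I := K).
  by move=> n x /asboolP /Idec ?; apply/asboolP.
exists N => x Ix; have : x \in K N by apply/asboolP.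
by rewrite -(NP N.+1 (leqnSn N)) => /asboolP.
Qed.

(** Without a minimal member, choice would produce an infinite strictly descending chain starting at
    [I0]. *)
Lemma artinian_minimal (P : (R^o -> Prop) -> Prop) (I0 : R^o -> Prop) :
  (forall I, P I -> is_submod I) -> P I0 ->
  exists2 I, P I & forall K, P K -> (forall x, K x -> I x) ->
    forall x, I x -> K x.
Proof.
move=> Psub P0; apply: contrapT => noI.
have step (I : {I | P I}) : exists K : {K | P K},
    (forall x, sval K x -> sval I x) /\ ~ (forall x, sval I x -> sval K x).
  case: I => I PI; apply: contrapT => noK; apply: noI; exists I => // K PK KI.
  by apply: contrapT => nIK; apply: noK; exists (exist _ K PK).
have [f fP] := choice step.
pose I n := iter n f (exist _ I0 P0).
have [n|n|N NP] := @artinian_chain (fun n => sval (I n)).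
- exact: Psub (svalP (I n)).
- by case: (fP (I n)).
- by case: (fP (I N)).
Qed.

Section MinimalNonFg.
Variable I : R^o -> Prop.
Hypothesis Isub : is_submod I.
Hypothesis Infg : ~ fg_sub I.
Hypothesis Imin : forall K : R^o -> Prop, is_submod K -> ~ fg_sub K ->
  (forall x, K x -> I x) -> forall x, I x -> K x.

(** [I] is an extension of [c I] by the kernel of [c] on [I], so these two are not both finitely
    generated, and by minimality one that is not is all of [I]. *)
Lemma minimal_nonfg_scale (c : R) :
  (forall x, I x -> c *: x = 0) \/
  (forall x, I x -> exists2 y, I y & x = c *: y).
Proof.
apply: contrapT => /not_orP[nann ndiv]; apply: Infg.
have [I0 Il] := Isub.
pose rho (m n : R^o) := I m /\ n = c *: m.
suff [s sP] : fg_sub (fun m => exists n, rho m n).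
  exists s => m; split=> [Im|/sP[n []] //].
  by apply/sP; exists (c *: m).
apply: fg_extension; rewrite /rho.
- by rewrite scaler0.
- move=> a x y x' y' [Ix ->] [Ix' ->]; split; first exact: Il.
  by rewrite scalerDr !scalerA mulrC.
- apply: contrapT => nfg; apply: nann => x /(Imin _ nfg) [].
  + split=> [|a z t [Iz cz] [It ct]]; first by rewrite scaler0.
    split; first exact: Il.
    by rewrite scalerDr -ct scalerA mulrC -scalerA -cz scaler0 addr0.
  + by move=> z [].
  + by [].
- apply: contrapT => nfg; apply: ndiv => x /(Imin _ nfg) [].
  + split=> [|a z t [m [Im ->]] [m' [Im' ->]]].
      by exists 0; rewrite scaler0.
    exists (a *: m + m'); split; first exact: Il.
    by rewrite scalerDr !scalerA mulrC.
  + by move=> z [m [Im ->]]; apply: (submodZ Isub).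
  + by move=> y [Iy ->]; exists y.
Qed.

(** This makes R/ann I a field, with [I] a vector space over it. *)
Lemma minimal_nonfg_inv (c : R) :
  (forall x, I x -> c *: x = 0) \/
  exists t : R, forall x, I x -> t *: (c *: x) = x.
Proof.
case: (minimal_nonfg_scale c) => [|cdiv]; [by left | right].
(* [K n] is the ideal (c^n) + ann I. Where the chain stops, c^N acts on [I] as t c^(N+1), and c^N
   cancels because every element of [I] is divisible by it. *)
pose K n (z : R^o) :=
  exists t : R, forall x, I x -> z *: x = t *: (c ^+ n *: x).
have [n|n x [t tP]|N NP] := @artinian_chain K.
- split=> [|a x y [t tP] [t' tP']].
    by exists 0 => x Ix; rewrite !scale0r.
  exists (a * t + t') => z Iz.
  transitivity (a *: (x *: z) + y *: z); first by rewrite scalerDl scalerA.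
  by rewrite tP // tP' // scalerDl -scalerA.
- exists (t * c) => y Iy; rewrite tP //.
  by rewrite exprS !scalerA mulrA.
have [|t tP] := NP (c ^+ N); first by exists 1 => x Ix; rewrite scale1r.
exists t => x Ix.
have [y Iy ->] : exists2 y, I y & x = c ^+ N *: y.
  elim: {NP tP}N => [|N [y Iy ->]]; first by exists x; rewrite ?scale1r.
  by have [z Iz ->] := cdiv y Iy; exists z => //; rewrite scalerA exprSr.
by rewrite [c *: _]scalerA -exprS -tP.
Qed.

(** A strictly increasing sequence of spans in [I] that avoids [x0] has a proper union [K]. By
    minimality [K] is finitely generated, hence equal to one of its stages, a contradiction. *)
Lemma no_minimal_nonfg : False.
Proof.
have nspan (s : seq R^o) : (forall x, x \in s -> I x) ->
    exists2 x, I x & ~ span s x.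
  move=> sI; apply: contrapT => no; apply: Infg; exists s => m; split.
    by move=> Im; apply: contrapT => nm; apply: no; exists m.
  exact: (submod_span Isub).
have [|x0 Ix0 nx0] := nspan [::] => //.
(* [p s] lies outside the span of [x0 :: s]; lists not contained in [I] get the junk value 0. *)
have /choice[p pP] : forall s : seq R^o, exists x, (forall x, x \in s -> I x) ->
    I x /\ ~ span (x0 :: s) x.
  move=> s; have [sI|nsI] := pselect (forall x, x \in s -> I x); last first.
    by exists 0 => /nsI.
  have [|x Ix nx] := nspan (x0 :: s); last by exists x.
  by move=> x; rewrite inE => /orP[/eqP->|/sI].
pose t n := iter n (fun s => p s :: s) [::].
have tI n : forall x, x \in t n -> I x.
  elim: n => // n IH x; rewrite inE => /orP[/eqP->|/IH //].
  by case: (pP _ IH).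
pose K z := exists n, span (t n) z.
have tS n k z : span (t n) z -> span (t (k + n)%N) z.
  by elim: k => // k IH /IH; exact: span_cons.
have Ksub : is_submod K.
  split=> [|a x y [n nx] [k ky]]; first by exists 0%N.
  exists (n + k)%N; have [_] := span_submod (t (n + k)%N); apply.
    by rewrite addnC; apply: tS.
  exact: tS.
have nK : ~ K x0.
  case=> n; elim: n => // n IH [c xc].
  (* Exchange argument: if [c] acts as zero, [x0] is already in the span of [t n]; if [c] is
     invertible, [p (t n)] is in the span of [x0 :: t n]. *)
  have [/(_ (p (t n)))|[u uP]] := minimal_nonfg_inv c.
    case: (pP _ (tI n)) => Ip _ /(_ Ip) c0; apply: IH.
    by rewrite c0 subr0 in xc.
  have [Ip np] := pP _ (tI n); apply: np.
  rewrite -(uP _ Ip); apply: (submodZ (span_submod _)).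
  rewrite -[c *: _](subKr x0); apply: (submodB (span_submod _)).
    exact: span_head.
  exact: span_cons.
have KI x : K x -> I x by case=> n; apply: (submod_span Isub (tI n)).
have [s sP] : fg_sub K.
  by apply: contrapT => nfg; apply: nK; apply: (Imin Ksub nfg KI).
have [N NP] : exists N, forall x, x \in s -> span (t N) x.
  have : forall x, x \in s -> K x by move=> x /span_in/sP.
  elim: s {sP} => [|g s IH] sK; first by exists 0%N.
  have [x xs|N NP] := IH; first by apply: sK; rewrite inE xs orbT.
  have [n ng] := sK g (mem_head g s).
  exists (n + N)%N => x; rewrite inE => /orP[/eqP->|/NP].
    by rewrite addnC; apply: tS.
  exact: tS.
(* The stage [t N] spans all of [K], including the next choice [p (t N)]. *)
have [_] := pP _ (tI N); apply; apply: span_cons.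
apply: (submod_span (span_submod _) NP); apply/sP.
by exists N.+1; apply: span_head.
Qed.

End MinimalNonFg.

Lemma artinian_noetherian (I : R^o -> Prop) : is_submod I -> fg_sub I.
Proof.
move=> Isub; apply: contrapT => nfg.
have [|//|K [Ksub Knfg] Kmin] :=
  @artinian_minimal (fun I => is_submod I /\ ~ fg_sub I) I.
  by move=> ? [].
exact: (no_minimal_nonfg Ksub Knfg (fun L Ls Ln => Kmin L (conj Ls Ln))).
Qed.

(** Induction on the generators: [rho] relates an element of [U] to its possible coefficients at
    [g]. Its kernel lies in the span of [s], and its range is an ideal of [R]. *)
Lemma fg_submod (M : lmodType R) (s : seq M) (U : M -> Prop) :
  is_submod U -> (forall x, U x -> span s x) -> fg_sub U.
Proof.
elim: s U => [|g s IH] U Usub Us.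
  by exists [::] => m; split=> [/Us|/= ->] //; case: Usub.
have [U0 Ul] := Usub; have [s0 sl] := span_submod s.
pose rho (m : M) (c : R^o) := U m /\ span s (m - c *: g).
suff [t tP] : fg_sub (fun m => exists n, rho m n).
  exists t => m; split=> [Um|/tP[n []] //].
  by apply/tP; have [c mc] := Us m Um; exists c.
have r0 : rho 0 0 by split=> //; rewrite scale0r subr0.
have rl a x y x' y' : rho x y -> rho x' y' ->
     rho (a *: x + x') (a *: y + y').
  move=> [Ux xy] [Ux' xy']; split; first exact: Ul.
  rewrite scalerDl -scalerA opprD addrACA -scalerBr.
  exact: sl.
apply: fg_extension => //.
- apply: IH => [|x [_]]; last by rewrite scale0r subr0.
  split=> // a x y xr yr; have := rl a _ _ _ _ xr yr.
  by rewrite scaler0 addr0.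
- apply: artinian_noetherian.
  split=> [|a x y [m xm] [m' ym]]; first by exists 0.
  by exists (a *: m + m'); apply: rl.
Qed.

Lemma fin_gen_injective (M N : lmodType R) (f : {linear N -> M}) :
  injective f -> fin_gen M -> fin_gen N.
Proof.
move=> finj /fin_gen_span[s sP]; apply: (fg_fin_gen finj).
apply: (@fg_submod _ s) => [|x _]; last exact: sP.
split=> [|a x y [n ->] [k ->]]; first by exists 0; rewrite linear0.
by exists (a *: n + k); rewrite linearP.
Qed.

End Hopkins.

(** * Linear maps into and out of quotient modules *)

Section QuotientProjection.
Variables (R : pzRingType) (V : lmodType R) (U : submodClosed V).

Definition quot_pi (x : V) : quot_mod U := \pi x.

Lemma quot_pi_linear : linear quot_pi.
Proof. by move=> a x y; apply: quot_mod_piP. Qed.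

HB.instance Definition _ := GRing.isLinear.Build R _ _ _ quot_pi quot_pi_linear.

Definition quot_piL : {linear V -> quot_mod U} := quot_pi.

End QuotientProjection.

Section QuotientLift.
Variables (R : pzRingType) (V W : lmodType R) (U : submodClosed V).
Variable L : {linear V -> W}.
Hypothesis LU : forall x, x \in U -> L x = 0.

Definition quot_lift (x : quot_mod U) : W := L (repr x).

Lemma quot_liftE x : quot_lift (\pi_(quot_mod U) x) = L x.
Proof.
have /quot_mod_eqP/LU : \pi_(quot_mod U) (repr (\pi_(quot_mod U) x))
  = \pi_(quot_mod U) x by rewrite reprK.
by rewrite linearB => /eqP; rewrite subr_eq0 => /eqP.
Qed.

Lemma quot_lift_linear : linear quot_lift.
Proof.
move=> a x y; rewrite -[x]reprK -[y]reprK -quot_mod_piP !quot_liftE.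
by rewrite linearP.
Qed.

HB.instance Definition _ :=
  GRing.isLinear.Build R _ _ _ quot_lift quot_lift_linear.

Definition quot_liftL : {linear quot_mod U -> W} := quot_lift.

End QuotientLift.

(** Both [f] and [psi] descend to M/ker f, where [f] becomes injective and the injectivity of [J]
    applies. *)
Lemma injective_modR_factor (R : comPzRingType) (J M N : lmodType R)
    (f : {linear M -> N}) (psi : {linear M -> J}) :
  injective_modR J -> fin_gen M -> fin_gen N ->
  (forall x, f x = 0 -> psi x = 0) ->
  exists phi : {linear N -> J}, forall x, phi (f x) = psi x.
Proof.
move=> Jinj [n [g gP]] Nfg fpsi.
have cl : submod_closed (fun x : M => f x == 0).
  split=> [|a x y /eqP fx /eqP fy]; apply/eqP; first by rewrite linear0.
  by rewrite linearP fx fy scaler0 addr0.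
pose K : submodClosed M := HB.pack (fun x : M => f x == 0)
    (GRing.isSubmodClosed.Build R _ (fun x : M => f x == 0) cl).
have fK x : x \in K -> f x = 0 by move/eqP.
have psiK x : x \in K -> psi x = 0 by move/fK/fpsi.
have Qfg : fin_gen (quot_mod K).
  exists n, (fun i => quot_pi K (g i)) => m.
  have [c cm] := gP (repr m); exists c; rewrite -[m]reprK cm.
  rewrite -[LHS]/(quot_piL K _) linear_sum.
  by apply: eq_bigr => i _; rewrite linearZ.
have [|phi phiP] := Jinj _ _ (quot_liftL fK) (quot_liftL psiK) Qfg Nfg.
  move=> x y; rewrite -[x]reprK -[y]reprK /= !quot_liftE // => fxy.
  by apply/quot_mod_eqP/eqP; rewrite linearB fxy subrr.
by exists phi => x; have := phiP (quot_pi K x); rewrite /= !quot_liftE.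
Qed.

(** * The kernel of pulling back along a deflation *)

Section ExactSequence.
Variables (R : comPzRingType) (C : lin_category R) (E : bifunctor C C).
Variable s : realization E.
Hypothesis Eext : extriangulated s.

(* The sequence 0 -> Y -> Y realizes 0, which reduces both facts below to
   completing morphisms between realizing sequences. *)
Lemma realization_id (Y : C) : exists Z : C, s (0 : E Y Z) 0 (idm Y).
Proof.
case: Eext => [[[Z Z0] _] [_ _ real0 _] _ _ _ _].
exists Z; apply: (real0 Z Y Y 0 (idm Y) 0 (idm Y)).
have c0l (A B B' : C) (f : mor A B) : (0 : mor B B') \oc f = 0.
  by rewrite -(subrr 0) comp_subl subrr.
have c0r (A B B' : C) (g : mor B B') : g \oc (0 : mor A B) = 0.
  by rewrite -(subrr 0) comp_subr subrr.
by split; rewrite ?comp_idl ?c0l ?c0r ?add0r ?Z0.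
Qed.

(** The maps [idm Y] and [y] go from the sequence Z -> Y -> Y realizing 0 to that of [d]; completing
    them by [a] gives y^* d = a_* 0. *)
Lemma pull_deflation (X A Y : C) (d : E X A) (x : mor A Y) (y : mor Y X) :
  s d x y -> pull E y d = 0.
Proof.
move=> sd; have [Z sZ] := realization_id Y.
case: Eext => _ _ _ et3op _ _.
have [|a [_ am]] := et3op _ _ _ _ _ _ _ _ _ _ _ _ (idm Y) y sZ sd.
  by rewrite !comp_idr.
by rewrite -am linear0.
Qed.

Lemma pull_deflation_ker (X A Y T : C) (d : E X A) (x : mor A Y) (y : mor Y X)
    (t : E X T) :
  s d x y -> pull E y t = 0 -> exists a : mor A T, t = push E a d.
Proof.
move=> sd yt; have [Z sZ] := realization_id Y.
case: Eext => _ [real ext _ _] _ et3op _ _.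
(* As y^* t = 0, [y] lifts to [g : Y -> W] through the deflation [w] of [t]. Completing [g] and
   [idm X] on the left then gives [a] with a_* d = t. *)
have [[W [v [w st]]] _] := real _ _ t.
have [|g [_ wg]] := ext _ _ _ _ _ _ _ _ _ _ _ _ 0 y sZ st.
  by rewrite /ext_morphism yt linear0.
have [|a [_ am]] := et3op _ _ _ _ _ _ _ _ _ _ _ _ g (idm X) sd st.
  by rewrite wg comp_idl comp_idr.
by exists a; rewrite am pull_id.
Qed.

End ExactSequence.

Lemma lin_functor_ext (R : comPzRingType) (C D : lin_category R) (F : C -> D)
    (G H : lin_functor F) :
  (forall A B (f : mor A B), fmap G f = fmap H f) -> G = H.
Proof.
case: G H => [G G1 G2] [H H1 H2] /= GH.
have E : G = H.
  apply: functional_extensionality_dep => A.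
  apply: functional_extensionality_dep => B.
  (* [dual_ext] serves as extensionality for linear maps into any module. *)
  by apply: (@dual_ext R) => f; apply: GH.
case: _ / E H1 H2 {GH} => H1 H2.
by rewrite (Prop_irrelevance G1 H1) (Prop_irrelevance G2 H2).
Qed.

Lemma quot_class_comp (R : comPzRingType) (C : lin_category R) (I : ideal C)
    (A B B' : C) (g : mor B B') (f : mor A B) :
  @mcomp R (quot_category I) A B B' (quot_class I g) (quot_class I f) =
  quot_class I (g \oc f).
Proof. exact: quot_compE. Qed.

(** * Descent of tau and eta to the stable categories of [F] *)

Section RelativeDuality.
Variables (R : comPzRingType) (J : lmodType R) (C : lin_category R).
Variables (E : bifunctor C C) (s : realization E).
Variables (F : bifunctor C C) (iota : subfunctor F E).
Variables (tau0 : C -> C) (ARS : right_ARS_duality E J tau0).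
Hypotheses (artR : artinian R) (Jic : injective_cogenerator_modR J).
Hypotheses (Eext : extriangulated s) (Efin : ext_finite E).

Let cE (A B : C) (f : mor A B) : @mor R (proj_stable E) A B :=
  quot_class (proj_ideal E) f.

Lemma F_fin_gen (X A : C) : fin_gen (F X A).
Proof.
exact: (fin_gen_injective artR (@incl_inj _ _ _ _ iota X A) (Efin X A)).
Qed.

(** Naturality of [ars_eta] on representatives in [C]; the chosen [repr] is harmless, since all
    representatives of tau a act alike on [E]. *)
Lemma eta_comp (A A' B B' : C) (a : mor A' A) (b : mor B B') (f : mor A B)
    (d : E B' (tau0 A')) :
  ars_eta ARS (cE (b \oc f \oc a)) d =
  ars_eta ARS (cE f) (pull E b (push E (repr (fmap (ars_tau ARS) (cE a))) d)).
Proof.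
have := ars_eta_natural ARS (cE a) (cE b) (cE f) d.
by rewrite /= /cE !quot_compE stable_pullE.
Qed.

Lemma eta_compl (A B B' : C) (b : mor B B') (f : mor A B) (d : E B' (tau0 A)) :
  ars_eta ARS (cE (b \oc f)) d = ars_eta ARS (cE f) (pull E b d).
Proof.
rewrite -[b \oc f]comp_idr eta_comp; congr (ars_eta ARS _ (pull E b _)).
rewrite (fmap_id (ars_tau ARS) A).
by have := @stable_pushE R C E B' _ _ (idm (tau0 A)) d; rewrite push_id.
Qed.

Lemma eta_compr (A A' B : C) (a : mor A' A) (f : mor A B) (d : E B (tau0 A')) :
  ars_eta ARS (cE (f \oc a)) d =
  ars_eta ARS (cE f) (push E (repr (fmap (ars_tau ARS) (cE a))) d).
Proof. by rewrite -[f]comp_idl eta_comp pull_id comp_idl. Qed.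

Lemma eta_onto (A B : C) (phi : {linear E B (tau0 A) -> J}) :
  exists f : mor A B, forall d, ars_eta ARS (cE f) d = phi d.
Proof.
have [g _ etaK] := ars_eta_bij ARS A B.
by exists (repr (g phi)) => d; rewrite /cE quot_reprK etaK.
Qed.

Lemma eta_inj (A B : C) (f g : mor A B) :
  (forall d, ars_eta ARS (cE f) d = ars_eta ARS (cE g) d) ->
  f - g \in proj_ideal E A B.
Proof.
move=> fg; apply/quot_classP; apply: (bij_inj (ars_eta_bij ARS A B)).
exact: dual_ext.
Qed.

(** This computes the kernel of eta restricted to [F]; the descent of tau and eta and the
    injectivity of the induced eta all rest on it. *)
Lemma eta_proj (A B : C) (f : mor A B) :
  f \in proj_ideal F A B <->
  forall d, ars_eta ARS (cE f) (incl iota d) = 0.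
Proof.
split=> [/proj_memP Pf d|etaf].
  by rewrite -[f]comp_idr eta_compl -incl_pull Pf !linear0.
apply/proj_memP => X d; apply: (@incl_inj _ _ _ _ iota).
rewrite incl_pull linear0.
have [[Y [x [y sd]]] _] :=
  realization_is_class (extriangulated_realization Eext) (incl iota d).
have [_ Jinj _] := Jic.
have [t yt|phi phiP] := injective_modR_factor (f := pull E y)
    (psi := ars_eta ARS (cE f)) Jinj (Efin _ _) (Efin _ _).
  have [a ->] := pull_deflation_ker Eext sd yt.
  by rewrite -incl_push etaf.
have [g gP] := eta_onto phi.
(* Here eta (y g) t = eta g (y^* t) = phi (y^* t) = eta f t. *)
have /proj_memP/(_ _ (incl iota d)) : f - y \oc g \in proj_ideal E A B.
  by apply: eta_inj => t; rewrite eta_compl gP phiP.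
rewrite addrC -scaleN1r pull_lin scaleN1r pull_comp (pull_deflation Eext sd).
by rewrite linear0 oppr0 add0r.
Qed.

Lemma tau_proj (A A' : C) (a : mor A A') :
  a \in proj_ideal F A A' ->
  repr (fmap (ars_tau ARS) (cE a)) \in inj_ideal F (tau0 A) (tau0 A').
Proof.
move=> Pa; apply/inj_memP => X d; apply: (@incl_inj _ _ _ _ iota).
rewrite linear0 incl_push; have [_ _ Jcog] := Jic.
set ta := repr _.
(* The cogenerator property tests maps out of finitely generated modules, hence [F_fin_gen]. Each
   test functional is then written as some eta f. *)
apply: (Jcog _ _ (push E ta \o incl iota) \0 (F_fin_gen _ _) (Efin _ _)).
move=> phi {}d /=.
have [f fP] := eta_onto phi.
rewrite -fP -eta_compr linear0; exact: (proj1 (eta_proj _) (ideal_compl _ Pa)).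
Qed.

(** The action of pi' tau on morphisms of [C], to be factored through C/P_F. *)
Let tau_mor (A B : C) :
    {linear mor A B -> @mor R (inj_stable F) (tau0 A) (tau0 B)} :=
  fmap (inj_functor iota) \o fmap (ars_tau ARS) \o quot_piL (proj_ideal E A B).

Let tau_mor0 (A B : C) (f : mor A B) :
  f \in proj_ideal F A B -> tau_mor A B f = 0.
Proof.
move=> /tau_proj Pf; rewrite -(linear0 (quot_piL (inj_ideal F _ _))).
by apply/quot_classP; rewrite subr0.
Qed.

Let tauF (A B : proj_stable F) :
    {linear mor A B -> @mor R (inj_stable F) (tau0 A) (tau0 B)} :=
  quot_liftL (@tau_mor0 A B).

Let tauFE (A B : C) (f : mor A B) :
  tauF A B (quot_class (proj_ideal F) f) =
  fmap (inj_functor iota) (fmap (ars_tau ARS) (cE f)).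
Proof. exact: (quot_liftE (@tau_mor0 A B)). Qed.

Let tauF_id (A : proj_stable F) : tauF A A (idm A) = idm (tau0 A : inj_stable F).
Proof.
rewrite -[idm A]/(quot_class _ _) tauFE.
by rewrite (fmap_id (ars_tau ARS) A) (fmap_id (inj_functor iota)).
Qed.

Let tauF_comp (A B B' : proj_stable F) (g : mor B B') (f : mor A B) :
  tauF A B' (g \oc f) = tauF B B' g \oc tauF A B f.
Proof.
elim/quot_mor_ind: g => g; elim/quot_mor_ind: f => f.
rewrite quot_class_comp !tauFE.
rewrite -(fmap_comp (inj_functor iota)) -(fmap_comp (ars_tau ARS)).
by rewrite quot_class_comp.
Qed.

Definition relative_tau : @lin_functor R (proj_stable F) (inj_stable F) tau0 :=
  LinFunctor tauF_id tauF_comp.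

(** This is D(iota), named so that it can carry a linear structure. *)
Let res (A B : C) (phi : dual_mod J (E B (tau0 A))) :
    dual_mod J (F B (tau0 A)) :=
  dual_map (@incl R C F E iota B (tau0 A)) phi.

Let res_linear (A B : C) : linear (@res A B).
Proof. by move=> a phi psi; apply: dual_ext. Qed.

HB.instance Definition _ A B :=
  GRing.isLinear.Build R _ _ _ (@res A B) (@res_linear A B).

Let eta_mor (A B : C) : {linear mor A B -> dual_mod J (F B (tau0 A))} :=
  @res A B \o (@ars_eta _ _ _ _ _ ARS A B) \o quot_piL (proj_ideal E A B).

Let eta_mor0 (A B : C) (f : mor A B) :
  f \in proj_ideal F A B -> eta_mor A B f = 0.
Proof. by move=> /eta_proj Pf; apply: dual_ext => d; apply: Pf. Qed.

Definition relative_eta (A B : proj_stable F) :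
    {linear mor A B -> dual_mod J (stable_ext F B (tau0 A))} :=
  quot_liftL (@eta_mor0 A B).

Lemma relative_etaE (A B : C) (f : mor A B) (d : F B (tau0 A)) :
  relative_eta A B (quot_class (proj_ideal F) f) d =
  ars_eta ARS (cE f) (incl iota d).
Proof.
by have -> : relative_eta A B (quot_class (proj_ideal F) f) = eta_mor A B f
  by exact: (quot_liftE (@eta_mor0 A B)).
Qed.

Lemma relative_eta_bij (A B : proj_stable F) : bijective (relative_eta A B).
Proof.
have inj : injective (relative_eta A B).
  move=> f g; elim/quot_mor_ind: f => f; elim/quot_mor_ind: g => g fg.
  apply/quot_classP/eta_proj => d.
  (* Reading [cE] as the linear projection [quot_piL] splits eta (f - g) into a difference. *)
  rewrite [cE _](linearB (quot_piL (proj_ideal E A B))) linearB /=.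
  rewrite -[ars_eta ARS _]/(ars_eta ARS (cE f)).
  have := relative_etaE f d; rewrite fg relative_etaE => e.
  by apply/eqP; rewrite subr_eq0; apply/eqP.
have onto phi : exists f, relative_eta A B f = phi.
  have [_ Jinj _] := Jic.
  (* As [incl] is injective, factoring through it means extending [phi] to [E]. *)
  have [|psi psiP] := injective_modR_factor (f := @incl R C F E iota B (tau0 A))
      (psi := phi) Jinj (F_fin_gen _ _) (Efin _ _).
    move=> x; rewrite -(linear0 (@incl R C F E iota B (tau0 A))).
    by move=> /incl_inj ->; rewrite linear0.
  have [f fP] := eta_onto psi.
  exists (quot_class _ f); apply: dual_ext => d.
  by rewrite relative_etaE fP psiP.
have [g gK] := choice onto.
by exists g => // f; apply: inj; rewrite gK.
Qed.

Lemma relative_eta_natural (A A' B B' : proj_stable F)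
    (a : mor A' A) (b : mor B B') (f : mor A B)
    (d : stable_ext F B' (tau0 A')) :
  relative_eta A' B' (b \oc f \oc a) d =
  relative_eta A B f
    (pull (stable_ext F) b (push (stable_ext F) (fmap relative_tau a) d)).
Proof.
elim/quot_mor_ind: a => a; elim/quot_mor_ind: b => b; elim/quot_mor_ind: f => f.
rewrite (quot_class_comp _ b f) (quot_class_comp _ _ a).
rewrite relative_etaE eta_comp relative_etaE.
rewrite -[pull (stable_ext F) _ _]/(stable_pull _ _ _) stable_pullE incl_pull.
(* By [tauFE] the induced tau of [a] is the class of the same representative that occurs in
   [eta_comp]. *)
rewrite -[fmap relative_tau _]/(tauF _ _ _) tauFE.
rewrite -[push (stable_ext F) _ _]/(stable_push _ _ _) stable_pushE.
by rewrite incl_push.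
Qed.

Definition relative_ARS_duality : right_ARS_duality F J tau0 :=
  RightARS relative_eta_bij relative_eta_natural.

Lemma relative_tau_comm :
  functor_comp (inj_functor iota) (ars_tau ARS) =
  functor_comp (ars_tau relative_ARS_duality) (proj_functor iota).
Proof.
apply: lin_functor_ext => A B; elim/quot_mor_ind => f /=.
rewrite quot_projE; last exact: proj_ideal_sub.
by rewrite -[RHS]/(tauF _ _ _) tauFE.
Qed.

Lemma relative_eta_comm (A B : proj_stable E) (f : mor A B) :
  dual_map (@incl R C F E iota B (tau0 A)) (ars_eta ARS f) =
  ars_eta relative_ARS_duality (fmap (proj_functor iota) f).
Proof.
elim/quot_mor_ind: f => f; apply: dual_ext => d.
have -> : fmap (proj_functor iota) (quot_class _ f) = quot_class _ f
  by apply: quot_projE; apply: proj_ideal_sub.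
by rewrite -[ars_eta relative_ARS_duality _]/(relative_eta _ _ _) relative_etaE.
Qed.

End RelativeDuality.

Theorem theorem1p1 (R : comPzRingType) (J : lmodType R) (C : lin_category R)
    (E : bifunctor C C) (s : realization E)
    (F : bifunctor C C) (iota : subfunctor F E)
    (tau0 : C -> C) (ARS : right_ARS_duality E J tau0) :
  artinian R ->
  minimal_injective_cogenerator J ->
  extriangulated s ->
  ext_finite E ->
  closed_subfunctor iota s ->
  exists ARSF : right_ARS_duality F J tau0,
    functor_comp (inj_functor iota) (ars_tau ARS) =
      functor_comp (ars_tau ARSF) (proj_functor iota) /\
    forall (A B : proj_stable E) (f : mor A B),
      dual_map (@incl R C F E iota B (tau0 A)) (ars_eta ARS f) =
      ars_eta ARSF (fmap (proj_functor iota) f).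
Proof.
move=> artR [Jic _] Eext Efin _.
exists (relative_ARS_duality iota ARS artR Jic Eext Efin).
by split=> [|A B f]; [apply: relative_tau_comm | apply: relative_eta_comm].
Qed.
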